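(* Let $q$ be a prime power, let $n\ge 2$, let $p\in\mathbb{P}^2(\overline{\mathbb{F}}_q)$ be a $q^n$-point, and let the line $\ell=\langle p,f(p)\rangle$ be a $q^k$-line. Then either $k=1$ or $k=n$. Moreover, $k=n$ precisely when $p$ does not lie on any $q$-line.
   Context: $f=\mathrm{Frob}_q$ acts on $\mathbb{P}^2(\overline{\mathbb{F}}_q)$ by raising coordinates to the $q$th power, and correspondingly on lines. A point (respectively line) whose $f$-orbit has exactly $n$ elements is called a $q^n$-point (respectively $q^n$-line); a $q$-line is a $q^1$-line, i.e. a line fixed by $f$. For distinct points $p_1,p_2$, $\langle p_1,p_2\rangle$ is the unique line containing both. *)

(* Defs.v *)
From HB Require Import structures.
From mathcomp Require Import all_boot all_order all_algebra all_field.

Set Implicit Arguments.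
Unset Strict Implicit.
Unset Printing Implicit Defensive.

Import GRing.Theory.
Local Open Scope ring_scope.

(* P^2(K) is the projectivization of K^3: points and lines are the subspaces  *)
(* of 'rV[K]_3 of dimension 1 and 2, incidence is inclusion, and the line     *)
(* through two distinct points is their sum (see join_point below).           *)
Definition is_point (K : fieldType) (U : {vspace 'rV[K]_3}) : Prop :=
  \dim U = 1%N.

Definition is_line (K : fieldType) (U : {vspace 'rV[K]_3}) : Prop :=
  \dim U = 2%N.

Definition frobv (K : fieldType) (q : nat) (v : 'rV[K]_3) : 'rV[K]_3 :=
  map_mx (fun x => x ^+ q) v.

(* The image of U under frobv, which is only semilinear; mem_frob shows that  *)
(* it is the pointwise image, hence independent of the choice of a basis.     *)
Definition frob (K : fieldType) (q : nat) (U : {vspace 'rV[K]_3}) :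
    {vspace 'rV[K]_3} :=
  <<[seq frobv q v | v <- vbasis U]>>%VS.

(* Forward iterates suffice: frob is injective on subspaces, so a finite      *)
(* forward orbit is closed under the inverse.                                 *)
Definition orbit_size (T : eqType) (f : T -> T) (x : T) (n : nat) : Prop :=
  exists s : seq T,
    [/\ uniq s, size s = n & forall y, y \in s <-> exists i, y = iter i f x].

Definition is_qpoint (K : fieldType) (q n : nat) (U : {vspace 'rV[K]_3}) :=
  is_point U /\ orbit_size (frob q) U n.

Definition is_qline (K : fieldType) (q n : nat) (U : {vspace 'rV[K]_3}) :=
  is_line U /\ orbit_size (frob q) U n.

Lemma join_point (K : fieldType) (p1 p2 : {vspace 'rV[K]_3}) :
    is_point p1 -> is_point p2 -> p1 <> p2 ->
  is_line (p1 + p2)%VS /\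
  forall l, is_line l -> (p1 <= l)%VS -> (p2 <= l)%VS -> l = (p1 + p2)%VS.
Proof.
rewrite /is_point /is_line => d1 d2 /eqP p12.
have cap0 : \dim (p1 :&: p2) = 0%N.
  apply/eqP; rewrite -leqn0 -ltnS ltn_neqAle.
  have le1 := dimvS (capvSl p1 p2); rewrite d1 in le1.
  rewrite le1 andbT; apply: contra p12 => /eqP dc.
  have e1 : (p1 :&: p2)%VS = p1 by apply/eqP; rewrite eqEdim capvSl d1 dc.
  have e2 : (p1 :&: p2)%VS = p2 by apply/eqP; rewrite eqEdim capvSr d2 dc.
  by rewrite -e1 e2.
have dj : \dim (p1 + p2) = 2%N.
  by have := dimv_sum_cap p1 p2; rewrite cap0 d1 d2 addn0.
split=> // l dl s1 s2; apply/eqP.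
by rewrite eq_sym eqEdim subv_add s1 s2 dl dj.
Qed.

Lemma frobvZ (K : fieldType) q (a : K) v : frobv q (a *: v) = a ^+ q *: frobv q v.
Proof. by apply/rowP => i; rewrite !mxE exprMn. Qed.

Lemma pnat_card_closure (F : finFieldType) (K : fieldType)
    (iota : {rmorphism F -> K}) :
  [pchar K].-nat #|F|.
Proof.
have [p pr_p charFp] := finPcharP F.
have charKp : p \in [pchar K] by rewrite (fmorph_pchar iota).
rewrite (eq_pnat _ (pcharf_eq charKp)) (card_pprimeChar charFp) pnatX pnat_id //.
Qed.

Lemma mem_frob (F : finFieldType) (K : closedFieldType)
    (iota : {rmorphism F -> K}) (U : {vspace 'rV[K]_3}) (w : 'rV[K]_3) :
  w \in frob #|F| U <-> exists2 v, v \in U & w = frobv #|F| v.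
Proof.
have qnat := pnat_card_closure iota.
set q := #|F| in qnat *.
have q_gt0 : (0 < q)%N by case/andP: qnat.
have frobv0 : frobv q (0 : 'rV[K]_3) = 0.
  by apply/rowP => i; rewrite !mxE expr0n gtn_eqF.
have frobvD : {morph @frobv K q : u v / u + v}.
  by move=> u v; apply/rowP => i; rewrite !mxE exprDn_pchar.
have root a : exists b : K, b ^+ q = a.
  have /closed_rootP[b] : size ('X^q - a%:P) != 1%N.
    by rewrite size_XnsubC // eqSS -lt0n.
  by rewrite /root !hornerE subr_eq0 => /eqP; exists b.
split.
  rewrite /frob.
  have : {subset tval (vbasis U) <= U} by move=> ?; apply: vbasis_mem.
  elim: (tval (vbasis U)) w => [|u s IHs] w sU /=.
    rewrite span_nil memv0 => /eqP->; exists 0; rewrite ?mem0v //.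
  rewrite span_cons => /memv_addP[_ /vlineP[a ->] [w2 w2s ->]].
  have [|v vU ->] := IHs w2 _ w2s; first by move=> x xs; rewrite sU // inE xs orbT.
  have [b <-] := root a.
  exists (b *: u + v); last by rewrite frobvD frobvZ.
  by apply: memvD => //; apply: memvZ; apply: sU; apply: mem_head.
case=> v vU ->; rewrite (coord_vbasis vU).
rewrite (big_morph _ frobvD frobv0) memv_suml // => i _.
by rewrite frobvZ memvZ // memv_span // map_f // mem_nth // size_tuple.
Qed.

Lemma frob_vline (F : finFieldType) (K : closedFieldType)
    (iota : {rmorphism F -> K}) (v : 'rV[K]_3) :
  frob #|F| <[v]>%VS = <[frobv #|F| v]>%VS.
Proof.
apply/eqP; rewrite eqEsubv; apply/andP; split; apply/subvP => w.
  move/(mem_frob iota) => [_ /vlineP[a ->] ->].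
  by rewrite frobvZ memvZ // memv_line.
case/vlineP=> a ->; rewrite memvZ //.
by apply/(mem_frob iota); exists v; rewrite // memv_line.
Qed.

(* Main.v *)
Require Import Defs.
From HB Require Import structures.
From mathcomp Require Import all_boot all_order all_algebra all_field.

Import GRing.Theory.
Local Open Scope ring_scope.

(** Write f for the Frobenius map and l = <p, f p>. Always f^n l = l, so k <= n.
    If l is not fixed by f, then l and f l meet exactly in f p, so f^k l = l
    forces f^k (f p) = f p, hence f^k p = p and n <= k. A fixed line through p
    also passes through f p, so it is l; thus p lies on a q-line iff k = 1. *)

Section OrbitSize.

Context {T : eqType} {f : T -> T}.

(** Once [iter i f x = x], exponents only matter modulo [i], so the first [i] iterates already
    exhaust the orbit. *)
Lemma orbit_size_min {x : T} {n i : nat} :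
  orbit_size f x n -> (0 < i)%N -> iter i f x = x -> (n <= i)%N.
Proof.
case=> s [uniq_s <- mem_s] i_gt0 fix_i.
rewrite -(size_traject f x i); apply: uniq_leq_size => // y /mem_s[j ->].
have fixM m : iter (m * i) f x = x.
  by elim: m => [|m IHm] //; rewrite mulSn iterD IHm.
rewrite (divn_eq j i) addnC iterD fixM.
by apply/trajectP; exists (j %% i)%N; rewrite ?ltn_pmod.
Qed.

Lemma orbit_size_gt0 {x : T} {n : nat} : orbit_size f x n -> (0 < n)%N.
Proof.
case=> s [_ <- mem_s].
have : x \in s by apply/mem_s; exists 0%N.
by case: s {mem_s}.
Qed.

(** Pigeonhole: among the iterates of exponent 0 to [n], two coincide, say at [i < j]. Injectivity
    cancels the common [iter i f], so [x] returns after [j - i <= n] steps, and [orbit_size_min]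
    makes this exactly [n]. *)
Lemma orbit_size_iter {x : T} {n : nat} :
  injective f -> orbit_size f x n -> iter n f x = x.
Proof.
move=> f_inj orb_n; have [s [_ sz_s mem_s]] := orb_n.
have iter_inj m : injective (iter m f).
  by elim: m => [|m IHm] a b //= /f_inj /IHm.
have not_uniq : ~~ uniq (traject f x n.+1).
  apply/negP => /uniq_leq_size le_size.
  have : (size (traject f x n.+1) <= size s)%N.
    by apply: le_size => y /trajectP[i _ ->]; apply/mem_s; exists i.
  by rewrite size_traject sz_s ltnn.
have /(uniqPn x)[i [j [ij]]] := not_uniq.
rewrite size_traject => j_le.
rewrite !nth_traject ?(ltn_trans ij) // -(subnKC (ltnW ij)) iterD.
move/iter_inj => /esym fix_ji.
have n_le : (n <= j - i)%N by apply: orbit_size_min fix_ji; rewrite ?subn_gt0.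
suff -> : n = (j - i)%N by [].
by apply/eqP; rewrite eqn_leq n_le (leq_trans (leq_subr _ _)).
Qed.

End OrbitSize.

Lemma dim_frob_le (K : fieldType) (q : nat) (U : {vspace 'rV[K]_3}) :
  (\dim (frob q U) <= \dim U)%N.
Proof. by apply: leq_trans (dim_span _) _; rewrite size_map size_tuple. Qed.

Lemma dim_iter_frob_le (K : fieldType) (q i : nat) (U : {vspace 'rV[K]_3}) :
  (\dim (iter i (frob q) U) <= \dim U)%N.
Proof. by elim: i => //= i; apply/leq_trans/dim_frob_le. Qed.

Section Frobenius.

Context {F : finFieldType} {K : closedFieldType} (iota : {rmorphism F -> K}).

Local Notation frobF := (@frob K #|F|).

Lemma frobv_inj : injective (@frobv K #|F|).
Proof.
move=> u v /rowP e; apply/rowP => i; move: (e i); rewrite !mxE => {}e.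
have qnat := pnat_card_closure iota.
(* Write [u = (u - v) + v] entrywise: additivity of the q-th power turns equal powers into
   [(u - v) ^+ q = 0]. *)
have /eqP := e; rewrite -{1}(subrK (v 0 i) (u 0 i)) exprDn_pchar //.
by rewrite -subr_eq0 addrK expf_eq0 => /andP[_]; rewrite subr_eq0 => /eqP.
Qed.

Lemma frob_subv (U V : {vspace 'rV[K]_3}) :
  (frobF U <= frobF V)%VS = (U <= V)%VS.
Proof.
apply/idP/idP => /subvP sUV; apply/subvP => u.
  move=> uU; have /(mem_frob iota)[v vV /frobv_inj->] // : frobv #|F| u \in frobF V.
  by apply/sUV/(mem_frob iota); exists u.
move/(mem_frob iota) => [v vU ->].
by apply/(mem_frob iota); exists v => //; apply: sUV.
Qed.

Lemma iter_frob_subv (i : nat) (U V : {vspace 'rV[K]_3}) :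
  (iter i frobF U <= iter i frobF V)%VS = (U <= V)%VS.
Proof. by elim: i => //= i <-; apply: frob_subv. Qed.

Lemma frob_inj : injective frobF.
Proof.
move=> U V e; apply/eqP; rewrite eqEsubv.
by rewrite -(frob_subv U) -(frob_subv V) e subvv.
Qed.

Lemma frob_point (p : {vspace 'rV[K]_3}) : is_point p -> is_point (frobF p).
Proof.
move=> dim_p; have le1 := dim_frob_le _ #|F| p; rewrite dim_p in le1.
apply/eqP; rewrite eqn_leq le1 /= lt0n dimv_eq0.
(* The zero space is its own image, so by injectivity the image of a point is nonzero. *)
have -> : 0%VS = frobF 0%VS.
  by have := dim_frob_le K #|F| 0%VS; rewrite dimv0 leqn0 dimv_eq0 => /eqP.
by rewrite (inj_eq frob_inj) -dimv_eq0 dim_p.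
Qed.

Lemma iter_frob_point (i : nat) (p : {vspace 'rV[K]_3}) :
  is_point p -> is_point (iter i frobF p).
Proof. by move=> pP; elim: i => //= i; apply: frob_point. Qed.

(** The n-th iterate preserves inclusion and fixes both [p] and [frobF p], so the image contains
    their sum; its dimension cannot grow, whence equality. *)
Lemma join_frob_fixed (n : nat) (p : {vspace 'rV[K]_3}) :
  iter n frobF p = p -> iter n frobF (p + frobF p)%VS = (p + frobF p)%VS.
Proof.
move=> fix_p; apply/esym/eqP; rewrite eqEdim dim_iter_frob_le andbT subv_add.
rewrite -{1}fix_p iter_frob_subv addvSl /=.
by rewrite -{1}fix_p -iterS iterSr iter_frob_subv addvSr.
Qed.

(** An intersection of dimension above 1 would be all of [l], giving [l] inside [frobF l] and then
    equality by dimension. *)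
Lemma line_cap_frob (l p : {vspace 'rV[K]_3}) :
  is_line l -> is_point p -> (p <= l)%VS -> (frobF p <= l)%VS ->
  frobF l <> l -> (l :&: frobF l)%VS = frobF p.
Proof.
move=> dim_l dim_p p_l fp_l fl_l; apply/esym/eqP; rewrite eqEdim subv_cap fp_l.
rewrite frob_subv p_l (frob_point _ dim_p) /= leqNgt; apply/negP => cap_gt1.
have capE : (l :&: frobF l)%VS = l by apply/eqP; rewrite eqEdim capvSl dim_l.
apply: fl_l; apply/esym/eqP.
by rewrite eqEdim dim_frob_le -{1}capE capvSr.
Qed.

Lemma point_fixed_of_line (k : nat) (p : {vspace 'rV[K]_3}) :
  let l := (p + frobF p)%VS in
  is_point p -> is_line l -> frobF l <> l -> iter k frobF l = l ->
  iter k frobF p = p.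
Proof.
move=> l pP lL fl_l fix_l; apply/eqP.
rewrite eqEdim pP iter_frob_point // andbT -frob_subv.
(* After one extra Frobenius, the target [frobF p] becomes the intersection of [l] and [frobF l].
   What remains is that the k-th iterates of [frobF p] and of [p] lie in [l], which is its own k-th
   iterate. *)
rewrite -(line_cap_frob l p) ?addvSl ?addvSr // subv_cap frob_subv.
by rewrite -iterS iterSr -{1 2}fix_l !iter_frob_subv addvSl addvSr.
Qed.

End Frobenius.

(* K, with iota, is an algebraic closure of the field F with q elements. *)
Theorem corollary4p4 (q : nat) (F : finFieldType) (hq : #|F| = q)
    (K : closedFieldType) (iota : {rmorphism F -> K})
    (K_alg : integralRange iota)
    (n k : nat) (hn : (2 <= n)%N) (p : {vspace 'rV[K]_3})
    (hp : is_qpoint q n p) (hl : is_qline q k (p + frob q p)%VS) :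
  (k = 1%N \/ k = n) /\
  (k = n <-> ~ exists m : {vspace 'rV[K]_3}, is_qline q 1 m /\ (p <= m)%VS).
Proof.
case: q / hq hp hl => -[pP orb_p] [lL orb_l].
have f_inj := frob_inj iota.
have k_cases : k = 1%N \/ k = n.
  have [fix_l|/eqP fl_l] :=
    eqVneq (frob #|F| (p + frob #|F| p)%VS) (p + frob #|F| p)%VS.
    left; apply/eqP; rewrite eqn_leq (orbit_size_gt0 orb_l) andbT.
    exact: (@orbit_size_min _ _ _ _ 1 orb_l isT fix_l).
  right; apply/eqP; rewrite eqn_leq; apply/andP; split.
    apply: orbit_size_min orb_l (ltnW hn) _.
    exact/(join_frob_fixed iota)/(orbit_size_iter f_inj).
  apply: orbit_size_min orb_p (orbit_size_gt0 orb_l) _.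
  exact: (point_fixed_of_line iota) (orbit_size_iter f_inj orb_l).
split=> //; split=> [kn [m [[mL orb_m] p_m]]|no_qline].
  have fix_m : frob #|F| m = m := orbit_size_iter f_inj orb_m.
  (* Since [m] is fixed and contains [p], it contains both points spanning the join. Then [k = 1],
     against [k = n >= 2]. *)
  have lm : (p + frob #|F| p)%VS = m.
    apply/eqP; rewrite eqEdim lL mL subv_add p_m /=.
    by rewrite -{1}fix_m (frob_subv iota) p_m.
  rewrite lm in orb_l.
  have := @orbit_size_min _ _ _ _ 1 orb_l isT fix_m.
  by rewrite kn leqNgt hn.
(* If [k = 1], the join itself is a q-line through [p]. *)
case: k_cases => // k1; case: no_qline; exists (p + frob #|F| p)%VS.
by rewrite k1 in orb_l; split; [split | apply: addvSl].
Qed.
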